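(* For every integer $n \ge 3$, we have $\chi'_{st}(C_3 \,\square\, C_n) = 6$ if $n$ is divisible by $3$, and $\chi'_{st}(C_3 \,\square\, C_n) = 7$ otherwise.
   Context: A star edge-coloring of a graph $G$ is a proper edge-coloring of $G$ in which there is no bichromatic path and no bichromatic cycle of length four (i.e., with four edges). The star chromatic index $\chi'_{st}(G)$ is the minimum number of colors in a star edge-coloring of $G$. $C_m$ denotes the cycle on $m$ vertices. $G \,\square\, H$ denotes the Cartesian product: vertex set $V(G)\times V(H)$, with $(u,v)(u',v')$ an edge iff either $uu'\in E(G)$ and $v=v'$, or $u=u'$ and $vv'\in E(H)$. *)

(* Defs.v *)
From mathcomp Require Import all_boot.

Set Implicit Arguments.
Unset Strict Implicit.
Unset Printing Implicit Defensive.

Record sgraph := SGraph {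
  vertex :> finType;
  adj : rel vertex;
  adj_sym : symmetric adj;
  adj_irr : irreflexive adj }.

Section Cycle.
Variable m : nat.

Definition cycle_adj : rel 'I_m :=
  [rel i j : 'I_m |
     (i != j) && ((j == i.+1 %% m :> nat) || (i == j.+1 %% m :> nat))].

Fact cycle_adj_sym : symmetric cycle_adj.
Proof. by move=> i j; rewrite /cycle_adj /= eq_sym orbC. Qed.

Fact cycle_adj_irr : irreflexive cycle_adj.
Proof. by move=> i; rewrite /cycle_adj /= eqxx. Qed.

(* The cycle on m vertices when 3 <= m. *)
Definition cycle_graph := SGraph cycle_adj_sym cycle_adj_irr.
End Cycle.

Section CartesianProduct.
Variables G H : sgraph.

Definition cart_adj : rel (G * H) :=
  [rel x y | (adj x.1 y.1 && (x.2 == y.2)) || ((x.1 == y.1) && adj x.2 y.2)].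

Fact cart_adj_sym : symmetric cart_adj.
Proof.
move=> [u v] [u' v']; rewrite /cart_adj /=.
by rewrite (adj_sym u) (adj_sym v) (eq_sym u) (eq_sym v).
Qed.

Fact cart_adj_irr : irreflexive cart_adj.
Proof. by move=> [u v]; rewrite /cart_adj /= !adj_irr andbF. Qed.

Definition cart_prod := SGraph cart_adj_sym cart_adj_irr.
End CartesianProduct.

Section StarEdgeColoring.
Variable G : sgraph.

Definition edges : {set {set G}} :=
  [set [set xy.1; xy.2] | xy : G * G & adj xy.1 xy.2].

Definition edge := {e : {set G} | e \in edges}.

Definition is_path (s : seq G) := sorted (@adj G) s && uniq s.

Definition is_cycle (s : seq G) := cycle (@adj G) s && uniq s.

Definition path_edges (s : seq G) : seq {set G} :=
  if s is x :: p then pairmap (fun u v => [set u; v]) x p else [::].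

Definition cycle_edges (s : seq G) : seq {set G} :=
  if s is x :: p then path_edges (x :: rcons p x) else [::].

Section Coloring.
Variables (k : nat) (c : {ffun edge -> 'I_k}).

Definition proper_edge_coloring :=
  [forall e : edge, forall f : edge,
     (e != f) && (val e :&: val f != set0) ==> (c e != c f)].

Definition bichromatic (s : seq {set G}) :=
  #|[set c e | e : edge & val e \in s]| == 2.

Definition star_edge_coloring :=
  [&& proper_edge_coloring,
      [forall p : 5.-tuple G, is_path p ==> ~~ bichromatic (path_edges p)] &
      [forall p : 4.-tuple G, is_cycle p ==> ~~ bichromatic (cycle_edges p)]].
End Coloring.

Definition star_edge_colorable (k : nat) :=
  [exists c : {ffun edge -> 'I_k}, star_edge_coloring c].

Lemma edgeI (x y : G) : adj x y -> [set x; y] \in edges.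
Proof. by move=> xy; apply/imsetP; exists (x, y); rewrite ?inE. Qed.

Lemma set2_neq (x y : G) (B : {set G}) :
  (x \notin B) || (y \notin B) -> [set x; y] != B.
Proof. by apply: contraTneq => <-; rewrite !inE !eqxx orbT. Qed.

Lemma injective_not_bichromatic k (c : {ffun edge -> 'I_k}) (s : seq {set G}) :
  injective c -> {subset s <= edges} -> uniq s -> 2 < size s ->
  ~~ bichromatic c s.
Proof.
move=> c_inj sE us s2; rewrite /bichromatic card_imset //.
suff -> : #|[set e : edge | val e \in s]| = size s by case: eqP s2 => // ->.
rewrite -(card_uniqP us) -(card_imset _ val_inj); apply: eq_card => x.
apply/imsetP/idP => [[e]|xs]; first by rewrite inE => es ->.
by exists (exist _ x (sE _ xs)); rewrite ?inE.
Qed.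

Fact star_edge_colorable_ex : exists k, star_edge_colorable k.
Proof.
exists #|{: edge}|; apply/existsP; exists [ffun e => enum_rank e].
have c_inj : injective [ffun e : edge => enum_rank e].
  by move=> e f; rewrite !ffunE => /enum_rank_inj.
apply/and3P; split.
- apply/forallP=> e; apply/forallP=> f; apply/implyP=> /andP[ne _].
  by apply: contraNneq ne => /c_inj ->.
- apply/forallP=> -[[|v0 [|v1 [|v2 [|v3 [|v4 [|? ?]]]]]] //= sz].
  apply/implyP=> /andP[/= /and5P[e1 e2 e3 e4 _]].
  rewrite !inE !negb_or !andbT.
  move=> /and4P[/and4P[n01 n02 n03 n04] /and3P[n12 n13 n14] /andP[n23 n24] n34].
  apply: injective_not_bichromatic => //=.
    by move=> x; rewrite !inE => /or4P[] /eqP ->; apply: edgeI.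
  rewrite !inE !negb_or !andbT.
  do ?[apply/andP; split]; apply: set2_neq; rewrite !inE !negb_or;
    by rewrite ?n01 ?n02 ?n03 ?n04 ?n12 ?n13 ?n14 ?n23 ?n24 ?n34.
- apply/forallP=> -[[|v0 [|v1 [|v2 [|v3 [|? ?]]]]] //= sz].
  apply/implyP=> /andP[/= /and5P[e1 e2 e3 e4 _]].
  rewrite !inE !negb_or !andbT.
  move=> /and3P[/and3P[n01 n02 n03] /andP[n12 n13] n23].
  apply: injective_not_bichromatic => //=.
    by move=> x; rewrite !inE => /or4P[] /eqP ->; apply: edgeI.
  rewrite !inE !negb_or !andbT.
  do ?[apply/andP; split]; apply: set2_neq; rewrite !inE !negb_or;
    by rewrite ?n01 ?n02 ?n03 ?n12 ?n13 ?n23 ?(eq_sym _ v0) ?n01 ?n02 ?n03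
               ?orbT.
Qed.

Definition star_chromatic_index : nat := ex_minn star_edge_colorable_ex.
End StarEdgeColoring.

(* Main.v *)
Require Import Defs.
From mathcomp Require Import all_boot zify.

(** A star edge-coloring is the same as a symmetric proper coloring of adjacent
    pairs in which no non-backtracking walk with four edges is colored [abab].
    This condition is local, so it can be tested on the infinite prism
    [C_3 x path], which covers [C_3 x C_n] for every [n >= 3].

    Lower bounds: on four consecutive columns (21 edges) an exhaustive search up
    to renaming of colors finds no coloring with five colors, and shows that with
    six colors a triangle edge has the same color three columns further but a
    different one in the next column.  If [3] does not divide [n], going around
    the cycle contradicts this.

    Upper bounds: the 6-coloring of period 3 is repeated around the cycle, and a
    block of 4 (resp. 5) columns using a seventh color is inserted when
    [n = 1 (mod 3)] (resp. [n = 2 (mod 3)]).  Only finitely many windows of five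
    columns occur, and each is checked by computation. *)

Set Implicit Arguments.
Unset Strict Implicit.
Unset Printing Implicit Defensive.

(** * Star edge-colorings as colorings of walks *)

Record star_walk_coloring (T : eqType) (r : rel T) (k : nat)
    (col : T -> T -> nat) : Prop := StarWalkColoring {
  walk_sym : forall x y, r x y -> col x y = col y x;
  walk_bound : forall x y, r x y -> col x y < k;
  walk_proper : forall x y z, r x y -> r x z -> y != z -> col x y != col x z;
  walk_star : forall v0 v1 v2 v3 v4,
    r v0 v1 -> r v1 v2 -> r v2 v3 -> r v3 v4 ->
    v0 != v2 -> v1 != v3 -> v2 != v4 ->
    ~~ ((col v0 v1 == col v2 v3) && (col v1 v2 == col v3 v4)) }.

Section WalkColoring.
Variable G : sgraph.
Implicit Types (x y z : G) (e f : edge G).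

Lemma adj_neq x y : adj x y -> x != y.
Proof. by apply: contraTneq => ->; rewrite adj_irr. Qed.

Lemma set2_inj x y x' y' : [set x; y] = [set x'; y'] ->
  x = x' /\ y = y' \/ x = y' /\ y = x'.
Proof.
move=> E; have : x \in [set x'; y'] by rewrite -E set21.
have : y \in [set x'; y'] by rewrite -E set22.
have : x' \in [set x; y] by rewrite E set21.
have : y' \in [set x; y] by rewrite E set22.
by rewrite !inE; do 4![case/orP=> /eqP ?]; subst; auto.
Qed.

Lemma set2_eqr x y z : [set x; y] = [set x; z] -> y = z.
Proof. by case/set2_inj=> [[] | [-> ->]]. Qed.

Lemma edgeP e : exists x y, adj x y /\ val e = [set x; y].
Proof. by case: e => e /= /imsetP[[x y]]; rewrite inE => ? ->; exists x, y. Qed.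

Definition mk_edge x y (xy : adj x y) : edge G := exist _ [set x; y] (edgeI xy).

Section Bichromatic.
Variables (k : nat) (c : {ffun edge G -> 'I_k}) (e1 e2 e3 e4 : edge G).
Hypotheses (c12 : c e1 != c e2) (c23 : c e2 != c e3) (c34 : c e3 != c e4).

(** As consecutive edges differ in color, [c e1] and [c e2] already exhaust the two colors, which
    forces [c e3] and then [c e4]. *)
Lemma bichromaticE :
  bichromatic c [:: val e1; val e2; val e3; val e4] =
  (c e1 == c e3) && (c e2 == c e4).
Proof.
rewrite /bichromatic; set S := [set c e | e : edge G & _].
have SE : S = [set c e1; c e2; c e3; c e4].
  apply/setP=> a; rewrite !inE -!orbA; apply/imsetP/or4P => [[e] | ].
    by rewrite !inE !val_eqE => /or4P[] /eqP-> ->; rewrite eqxx;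
       [exact: Or41 | exact: Or42 | exact: Or43 | exact: Or44].
  by case=> /eqP->; [exists e1|exists e2|exists e3|exists e4];
     rewrite ?inE ?eqxx ?orbT.
have s12 : [set c e1; c e2] \subset S by rewrite SE -setUA subsetUl.
have card12 : #|[set c e1; c e2]| = 2 by rewrite cards2 c12.
apply/idP/andP => [/eqP S2 | [/eqP E13 /eqP E24]]; last first.
  rewrite SE -E13 -E24 -card12; apply/eqP/eq_card => a.
  by rewrite !inE; case: (a == c e1); case: (a == c e2).
have {}SE : [set c e1; c e2] = S by apply/eqP; rewrite eqEcard s12 S2 card12.
have: c e3 \in S by rewrite imset_f // inE !inE eqxx !orbT.
rewrite -SE !inE [c e3 == c e2]eq_sym (negPf c23) orbF eq_sym => /eqP E13.
have: c e4 \in S by rewrite imset_f // inE !inE eqxx !orbT.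
rewrite -SE !inE {1}E13 [c e4 == c e3]eq_sym (negPf c34) /= eq_sym => ->.
by rewrite E13.
Qed.
End Bichromatic.

Lemma walk_coloring_of_star k :
  star_edge_colorable G k -> exists col, star_walk_coloring (@adj G) k col.
Proof.
case/existsP=> c /and3P[/forallP propc /forallP pathc /forallP cycc].
pose col x y := oapp (fun e => c e : nat) k (insub [set x; y]).
have colE x y (xy : adj x y) : col x y = c (mk_edge xy).
  by rewrite /col insubT ?edgeI //= => h; congr (nat_of_ord (c _)); apply/val_inj.
have colC x y : col x y = col y x by rewrite /col setUC.
have colP x y z : adj x y -> adj x z -> y != z -> col x y != col x z.
  move=> xy xz yz; rewrite !colE val_eqE.
  have /forallP/(_ (mk_edge xz))/implyP := propc (mk_edge xy); apply.
  apply/andP; split; first by apply: contraNneq yz => /(congr1 val)/set2_eqr->.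
  by apply/set0Pn; exists x; rewrite !inE eqxx.
exists col; split=> // [x y xy | v0 v1 v2 v3 v4 a01 a12 a23 a34 n02 n13 n24].
  by rewrite colE.
have sw (x y : G) (xy : adj x y) : adj y x by rewrite adj_sym.
have p012 : col v0 v1 != col v1 v2 by rewrite colC; apply: colP; rewrite // sw.
have p123 : col v1 v2 != col v2 v3 by rewrite colC; apply: colP; rewrite // sw.
have p234 : col v2 v3 != col v3 v4 by rewrite colC; apply: colP; rewrite // sw.
apply/negP => /andP[/eqP E13 /eqP E24].
(* If [v0 = v3], the walk contains a triangle in which the edges [v0 v1] and [v2 v3] meet, so their
   colors differ; [v1 = v4] is excluded likewise. *)
have n03 : v0 != v3.
  apply/eqP=> E; rewrite -E in E13 a23.
  have := colP _ _ _ a01 (sw _ _ a23) (adj_neq a12).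
  by rewrite E13 colC eqxx.
have n14 : v1 != v4.
  apply/eqP=> E; rewrite -E in E24 a34.
  have := colP _ _ _ a12 (sw _ _ a34) (adj_neq a23).
  by rewrite E24 colC eqxx.
have bic : bichromatic c [:: [set v0; v1]; [set v1; v2]; [set v2; v3]; [set v3; v4]].
  move: E13 E24 p012 p123 p234; rewrite !colE => /val_inj E13 /val_inj E24.
  rewrite !val_eqE => p012 p123 p234.
  by have := bichromaticE p012 p123 p234; rewrite E13 E24 !eqxx.
(* A closed walk is now a 4-cycle, an open one a path on five vertices. *)
have [E | n04] := eqVneq v0 v4.
  rewrite -E in a34 bic; have := cycc [tuple v0; v1; v2; v3].
  rewrite /= bic implybF /is_cycle /= a01 a12 a23 a34 /=.
  by rewrite !inE !negb_or n02 n03 n13 !adj_neq.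
have := pathc [tuple v0; v1; v2; v3; v4].
rewrite /= bic implybF /is_path /= a01 a12 a23 a34 /=.
by rewrite !inE !negb_or n02 n03 n04 n13 n14 n24 !adj_neq.
Qed.

Lemma star_of_walk_coloring k col :
  star_walk_coloring (@adj G) k.+1 col -> star_edge_colorable G k.+1.
Proof.
case=> colC colk colP colS.
(* Either orientation of the edge may be picked, since [col] is symmetric on adjacent pairs. *)
pose c : {ffun edge G -> 'I_k.+1} := [ffun e =>
  if [pick xy : G * G | adj xy.1 xy.2 && (val e == [set xy.1; xy.2])] is Some xy
  then inord (col xy.1 xy.2) else ord0].
have cE e x y : adj x y -> val e = [set x; y] -> c e = col x y :> nat.
  move=> xy Ee; rewrite ffunE; case: pickP => [[x' y'] /= /andP[xy' ] | ].
    rewrite inordK ?colk // Ee => /eqP /set2_inj[] [-> ->] //.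
    by rewrite colC // adj_sym.
  by move/(_ (x, y)); rewrite /= xy Ee eqxx.
have cP e f x y z : adj x y -> adj x z -> y != z -> val e = [set x; y] ->
    val f = [set x; z] -> c e != c f.
  by move=> xy xz yz Ee Ef; rewrite -val_eqE /= (cE e x y) // (cE f x z) // colP.
have sw (x y : G) (xy : adj x y) : adj y x by rewrite adj_sym.
have bic v0 v1 v2 v3 v4 : adj v0 v1 -> adj v1 v2 -> adj v2 v3 -> adj v3 v4 ->
    v0 != v2 -> v1 != v3 -> v2 != v4 ->
    ~~ bichromatic c [:: [set v0; v1]; [set v1; v2]; [set v2; v3]; [set v3; v4]].
  move=> a01 a12 a23 a34 n02 n13 n24.
  have := colS _ _ _ _ _ a01 a12 a23 a34 n02 n13 n24.
  have H := @bichromaticE _ c (mk_edge a01) (mk_edge a12) (mk_edge a23) (mk_edge a34).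
  rewrite H; first by rewrite -!val_eqE /= !(cE (mk_edge _) _ _ _ erefl).
  - by apply: (cP _ _ v1 v0 v2 (sw _ _ a01) a12 n02) => //=; apply: setUC.
  - by apply: (cP _ _ v2 v1 v3 (sw _ _ a12) a23 n13) => //=; apply: setUC.
  - by apply: (cP _ _ v3 v2 v4 (sw _ _ a23) a34 n24) => //=; apply: setUC.
apply/existsP; exists c; apply/and3P; split.
- apply/forallP=> e; apply/forallP=> f; apply/implyP=> /andP[nef /set0Pn[x]].
  have mem e' : x \in val e' -> exists2 y, adj x y & val e' = [set x; y].
    have [y [z [yz ->]]] := edgeP e'; rewrite !inE => /orP[] /eqP->; first by exists z.
    by exists y; [apply: sw | apply: setUC].
  rewrite inE => /andP[/mem[y xy Ee] /mem[z xz Ef]]; apply: (cP _ _ x y z) => //.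
  by apply: contraNneq nef => yz; apply/eqP/val_inj; rewrite Ee Ef yz.
- apply/forallP=> -[[|v0 [|v1 [|v2 [|v3 [|v4 [|? ?]]]]]] //= sz].
  apply/implyP=> /andP[/= /and5P[a01 a12 a23 a34 _]].
  rewrite !inE !negb_or !andbT.
  move=> /and4P[/and4P[n01 n02 n03 n04] /and3P[n12 n13 n14] /andP[n23 n24] n34].
  exact: bic.
- apply/forallP=> -[[|v0 [|v1 [|v2 [|v3 [|? ?]]]]] //= sz].
  apply/implyP=> /andP[/= /and5P[a01 a12 a23 a30 _]].
  rewrite !inE !negb_or !andbT.
  move=> /and3P[/and3P[n01 n02 n03] /andP[n12 n13] n23].
  by apply: bic; rewrite // eq_sym.
Qed.
End WalkColoring.

(** * Exhaustive search up to renaming of colors *)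

(** Two equalities between positions of a color sequence that must not hold together; a properness
    constraint is one equality written twice. *)
Definition quad := ((nat * nat) * (nat * nat))%type.

Definition quad_clash (s : seq nat) (q : quad) :=
  (nth 0 s q.1.1 == nth 0 s q.1.2) && (nth 0 s q.2.1 == nth 0 s q.2.2).

Definition quad_max (q : quad) := maxn (maxn q.1.1 q.1.2) (maxn q.2.1 q.2.2).

Section Search.
Variables (K : nat) (P : pred (seq nat)).

(** [m] counts the colors used so far, so the next edge takes an old color or the single fresh color
    [m]. The head of [qss] holds the constraints to test once that edge is colored; a clash closes
    the branch. *)
Fixpoint search (qss : seq (seq quad)) (m : nat) (s : seq nat) : bool :=
  if qss is qs :: qss' then
    all (fun x => let s' := rcons s x in
           if has (quad_clash s') qs then true else search qss' (maxn m x.+1) s')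
        (iota 0 (minn m.+1 K))
  else P s.

(* [u] lists the colors of [w] in order of first appearance and [s] is the
   canonical relabeling of the part of [w] that has been assigned so far. *)
Lemma search_sound qss u s w' :
  let w := map (nth 0 u) s ++ w' in
  search qss (size u) s -> uniq u -> all (fun a => a < K) u ->
  all (fun a => a < size u) s ->
  size w' = size qss -> all (fun a => a < K) w' ->
  (forall i q, q \in nth [::] qss i ->
     quad_max q <= size s + i /\ ~~ quad_clash w q) ->
  exists u' s', [/\ uniq u', all (fun a => a < size u') s',
                    w = map (nth 0 u') s' & P s'].
Proof.
elim: qss u s w' => [|qs qss IH] u s [|a w'] //= Ps uu uK su.
  by exists u, s; rewrite cats0.
move=> [sz] /andP[aK w'K] ok.
(* A color absent from [u] has index [size u], which is exactly the fresh label tried by the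
   search. *)
pose x := index a u; pose u' := if a \in u then u else rcons u a.
have ax : nth 0 u' x = a.
  rewrite /u' /x; case: ifP => [/nth_index // | au].
  by rewrite memNindex ?au // nth_rcons ltnn eqxx.
have uu' : uniq u' by rewrite /u'; case: ifP => // au; rewrite rcons_uniq au.
have u'K : all (fun b => b < K) u'.
  by rewrite /u'; case: ifP => // au; rewrite all_rcons aK.
have size_u' : size u' = maxn (size u) x.+1.
  rewrite /u' /x; case: ifP => au; first by apply/esym/maxn_idPl; rewrite index_mem.
  by rewrite size_rcons memNindex ?au //; apply/esym/maxn_idPr.
have xu' : x < size u' by rewrite size_u' leq_maxr.
have map_u' : map (nth 0 u') s = map (nth 0 u) s.
  apply/eq_in_map => b /(allP su) bu; rewrite /u'; case: ifP => // _.
  by rewrite nth_rcons bu.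
have su' : all (fun b => b < size u') (rcons s x).
  rewrite all_rcons xu' /=.
  by apply: sub_all su => y yu; rewrite size_u' leq_max yu.
(* Distinct colors below [K] number at most [K], so the label [x] is among those tried. *)
have size_u'K : size u' <= K.
  rewrite -(size_iota 0 K); apply: uniq_leq_size => // b /(allP u'K).
  by rewrite mem_iota.
have wE : map (nth 0 u) s ++ a :: w' = map (nth 0 u') (rcons s x) ++ w'.
  by rewrite map_rcons map_u' ax cat_rcons.
have /(allP Ps) : x \in iota 0 (minn (size u).+1 K).
  rewrite mem_iota /= add0n leq_min ltnS index_size /=.
  exact: leq_trans size_u'K.
case: ifP => [/hasP[q qqs clash] | _ Ps'].
  have [qm /negP[]] := ok 0 q qqs; rewrite addn0 in qm.
  have nthE i : i <= size s ->
      nth 0 (map (nth 0 u) s ++ a :: w') i = nth 0 u' (nth 0 (rcons s x) i).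
    move=> is_; rewrite wE nth_cat size_map size_rcons ltnS is_.
    by rewrite (nth_map 0) // size_rcons ltnS.
  move: qm clash; rewrite /quad_max !geq_max => /andP[/andP[m1 m2] /andP[m3 m4]].
  by rewrite /quad_clash !nthE // => /andP[/eqP-> /eqP->]; rewrite !eqxx.
rewrite wE; apply: IH => //; first by rewrite size_u'.
move=> i q qi; have [] := ok i.+1 q qi.
by rewrite wE size_rcons addSnnS.
Qed.
End Search.

(** * The infinite prism and its window of four columns *)

Definition prism_adj : rel (nat * nat) := [rel u v |
  [&& u.2 < 3, v.2 < 3 &
      ((u.1 == v.1) && (u.2 != v.2))
   || ((u.2 == v.2) && ((v.1 == u.1.+1) || (u.1 == v.1.+1)))]].

Definition triangle_edges i : seq ((nat * nat) * (nat * nat)) :=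
  [:: ((i, 0), (i, 1)); ((i, 1), (i, 2)); ((i, 2), (i, 0))].
Definition rung_edges i : seq ((nat * nat) * (nat * nat)) :=
  [:: ((i, 0), (i.+1, 0)); ((i, 1), (i.+1, 1)); ((i, 2), (i.+1, 2))].

Definition window_edges :=
  triangle_edges 0 ++ rung_edges 0 ++ triangle_edges 1 ++ rung_edges 1 ++
  triangle_edges 2 ++ rung_edges 2 ++ triangle_edges 3.

Definition window_vertices := [seq (i, j) | i <- iota 0 4, j <- iota 0 3].

Definition nbrs v := [seq u <- window_vertices | prism_adj v u].

(** [index] returns the length of the list for an orientation that is not listed, so the minimum
    selects the listed one. *)
Definition edge_index u v : nat :=
  minn (index (u, v) window_edges) (index (v, u) window_edges).

Definition window_cherries :=
  [seq t <- [seq (p.1, v, p.2) | v <- window_vertices,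
                                 p <- [seq (x, y) | x <- nbrs v, y <- nbrs v]]
     | t.1.1 != t.2].

Definition window_walks :=
  [seq w <- [seq (t, p) | t <- window_cherries,
                          p <- [seq (x, y) | x <- nbrs t.1.1, y <- nbrs t.2]]
     | (w.2.1 != w.1.1.2) && (w.2.2 != w.1.1.2)].

Definition window_quads : seq quad :=
  [seq let e := (edge_index t.1.1 t.1.2, edge_index t.1.2 t.2) in (e, e)
     | t <- window_cherries] ++
  [seq let: (v1, v2, v3, (v0, v4)) := w in
       ((edge_index v0 v1, edge_index v2 v3), (edge_index v1 v2, edge_index v3 v4))
     | w <- window_walks].

(** A constraint is filed under its largest position, the moment when all its edges have just been
    colored, so that it prunes as early as possible. *)
Definition levels (m : nat) (qs : seq quad) :=
  [seq [seq q <- qs | quad_max q == i] | i <- iota 0 m].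

Definition window_levels := levels (size window_edges) window_quads.

Lemma prism_adj_sym : symmetric prism_adj.
Proof.
move=> u v; rewrite /prism_adj /= (eq_sym u.1 v.1) !(eq_sym u.2) andbCA.
by rewrite [X in _ || (_ && X)]orbC.
Qed.

Lemma mem_levels (qs : seq quad) m i q :
  q \in nth [::] (levels m qs) i ->
  quad_max q = i /\ q \in qs.
Proof.
have [lt_i | ge_i] := ltnP i m; last by rewrite nth_default ?size_map ?size_iota.
rewrite (nth_map 0) ?size_iota // nth_iota // mem_filter.
by case/andP=> /eqP-> ->.
Qed.

Lemma window_edges_cover :
  all (fun u => all (fun v => prism_adj u v ==>
    (edge_index u v < size window_edges) &&
    (nth (u, v) window_edges (edge_index u v) \in [:: (u, v); (v, u)]))
  window_vertices) window_vertices.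
Proof. by vm_compute. Qed.

Definition window_colors (col : nat * nat -> nat * nat -> nat) :=
  [seq col e.1 e.2 | e <- window_edges].

Section PrismColoring.
Variables (K : nat) (col : nat * nat -> nat * nat -> nat).
Hypothesis colP : star_walk_coloring prism_adj K col.
Local Notation w := (window_colors col).


Lemma nth_edge_index u v : u \in window_vertices -> v \in window_vertices ->
  prism_adj u v -> nth 0 w (edge_index u v) = col u v.
Proof.
move=> uV vV uv; have /allP/(_ v vV) := allP window_edges_cover u uV.
rewrite uv => /andP[lt]; rewrite !inE (nth_map (u, v)) //.
by case/orP=> /eqP-> //=; rewrite -(walk_sym colP uv).
Qed.

Lemma mem_nbrs v u : (u \in nbrs v) = prism_adj v u && (u \in window_vertices).
Proof. by rewrite mem_filter. Qed.

Lemma mem_cherries t : t \in window_cherries ->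
  [/\ t.1.2 \in window_vertices, t.1.1 \in nbrs t.1.2, t.2 \in nbrs t.1.2
    & t.1.1 != t.2].
Proof.
rewrite mem_filter => /andP[ne /allpairsPdep[v [p [vV pp Et]]]].
by move: ne; rewrite {}Et /=; case/allpairsPdep: pp => x [y [xv yv ->]].
Qed.

Lemma mem_walks v1 v2 v3 v0 v4 : (v1, v2, v3, (v0, v4)) \in window_walks ->
  [/\ (v1, v2, v3) \in window_cherries, v0 \in nbrs v1, v4 \in nbrs v3,
      v0 != v2 & v4 != v2].
Proof.
rewrite mem_filter => /andP[/andP[n02 n42] /allpairsPdep].
case=> t [p [tc pp [Et Ep]]]; subst t p.
by case/allpairsPdep: pp => x [y [xv yv [Ex Ey]]]; subst x y.
Qed.

Lemma window_quads_ok q : q \in window_quads -> ~~ quad_clash w q.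
Proof.
rewrite mem_cat => /orP[] /mapP[].
  move=> [[x v] y] /mem_cherries[/= vV]; rewrite !mem_nbrs.
  move=> /andP[vx xV] /andP[vy yV] ne ->; rewrite /quad_clash /= andbb.
  have xv : prism_adj x v by rewrite prism_adj_sym.
  have := walk_proper colP vx vy ne; rewrite (walk_sym colP vx).
  by rewrite -(nth_edge_index xV vV xv) -(nth_edge_index vV yV vy).
move=> [[[v1 v2] v3] [v0 v4]] /mem_walks[/mem_cherries[/= v2V]].
rewrite !mem_nbrs => /andP[a21 v1V] /andP[a23 v3V] n13.
move=> /andP[a10 v0V] /andP[a34 v4V] n02 n42 ->; rewrite /quad_clash /=.
rewrite prism_adj_sym in a21; rewrite prism_adj_sym in a10.
have n24 : v2 != v4 by rewrite eq_sym.
have := walk_star colP a10 a21 a23 a34 n02 n13 n24.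
rewrite -(nth_edge_index v0V v1V a10) -(nth_edge_index v2V v3V a23).
by rewrite -(nth_edge_index v1V v2V a21) -(nth_edge_index v3V v4V a34).
Qed.

Lemma prism_search (P : pred (seq nat)) : search K P window_levels 0 [::] ->
  exists u s, [/\ uniq u, all (fun a => a < size u) s, w = map (nth 0 u) s & P s].
Proof.
move=> sP; apply: (@search_sound K P window_levels [::] [::] w) => //.
  apply/allP=> _ /mapP[e eE ->]; apply: (walk_bound colP).
  by move: e eE; apply/allP.
by move=> i q /mem_levels[-> /window_quads_ok].
Qed.
End PrismColoring.

(* Positions 0, 6 and 18 of [window_edges] hold the edge between rows 0 and 1 in
   columns 0, 1 and 3. *)
Definition shifted_repeat (s : seq nat) :=
  (nth 0 s 18 == nth 0 s 0) && (nth 0 s 6 != nth 0 s 0).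

(** With the goal [pred0], success means that every branch is cut by a clash before the window is
    complete. *)
Lemma search5 : search 5 pred0 window_levels 0 [::].
Proof. by vm_compute. Qed.

Lemma search6 : search 6 shifted_repeat window_levels 0 [::].
Proof. by vm_compute. Qed.

Lemma prism_not5 col : ~ star_walk_coloring prism_adj 5 col.
Proof. by move=> colP; have [u [s []]] := prism_search colP search5. Qed.

Lemma prism_6_periodic col : star_walk_coloring prism_adj 6 col ->
  col (3, 0) (3, 1) = col (0, 0) (0, 1) /\ col (1, 0) (1, 1) != col (0, 0) (0, 1).
Proof.
move=> colP.
have [u [s [uu su ws /andP[/eqP E30 n10]]]] := prism_search colP search6.
have sz : size s = 21 by rewrite -(size_map (nth 0 u)) -ws.
have nths i : i < 21 -> nth 0 u (nth 0 s i) =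
    nth 0 (window_colors col) i.
  by move=> lt_i; rewrite ws (nth_map 0) ?sz.
have s_lt i : i < 21 -> nth 0 s i < size u.
  by move=> lt_i; apply: (allP su); rewrite mem_nth ?sz.
have := nths 0 isT; have := nths 6 isT; have := nths 18 isT.
rewrite /= => <- <- <-; rewrite E30; split=> //.
(* Labels are positions in the duplicate-free list [u], so distinct labels are distinct colors. *)
by rewrite nth_uniq ?s_lt.
Qed.

(** * The covering of [C_3 x C_n] by the prism *)

Lemma modn_near n a b : 2 < n -> a <= b <= a + 2 -> a = b %[mod n] -> a = b.
Proof.
move=> n3 /andP[ab ba] /eqP; rewrite -(subnKC ab) -{1}[a]addn0 eqn_modDl.
by rewrite !modn_small; lia.
Qed.

Section Covering.
Variables (n : nat) (n3 : 2 < n).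
Let n_gt0 : 0 < n := ltn_trans (isT : 0 < 2) n3.
Notation G := (cart_prod (cycle_graph 3) (cycle_graph n)).

(** The covering map, winding the prism around the cycle from column [x] on. The coordinates change
    places, since the prism lists the column first. *)
Definition roll (x : nat) (u : nat * nat) : G :=
  (inord u.2 : 'I_3, Ordinal (ltn_pmod (x + u.1) n_gt0)).

Lemma roll_shift x i u : roll (x + i) u = roll x (i + u.1, u.2).
Proof. by congr pair; apply: val_inj; rewrite /= addnA. Qed.

Lemma roll_period x u : roll (x + n) u = roll x u.
Proof. by congr pair; apply: val_inj; rewrite /= addnAC modnDr. Qed.

Lemma adj3 (i j : 'I_3) : cycle_adj i j = (i != j).
Proof. by case: i j => [[|[|[|?]]] ?] [[|[|[|?]]] ?]. Qed.

Lemma roll_adj x u v : prism_adj u v -> adj (roll x u) (roll x v).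
Proof.
case: u v => [i j] [i' j'] /and3P[/= j3 j3' /orP[] /andP[/eqP<-]] => [ne | E].
  apply/orP; left; rewrite /= eqxx andbT adj3.
  by rewrite -val_eqE /= !inordK.
apply/orP; right; rewrite /= eqxx /=.
wlog : i i' E / i' = i.+1.
  by move=> wl; case/orP: E => /eqP E; last rewrite cycle_adj_sym; apply: wl; rewrite // E eqxx ?orbT.
move=> {E} ->; apply/andP; split.
  rewrite -val_eqE /=; apply/negP => /eqP /(modn_near n3); lia.
by rewrite /= -[X in _ == X %% n]addn1 modnDml addn1 addnS eqxx.
Qed.

(** Local surjectivity of the covering; column 0 is excluded because the prism has no column to its
    left. *)
Lemma roll_lift x u y : 0 < u.1 -> u.2 < 3 -> adj (roll x u) y ->
  exists2 v, prism_adj u v & y = roll x v.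
Proof.
case: u y => [i j] [r z] /= i0 j3 /orP[] /= /andP[].
  rewrite adj3 => ne /eqP<-; exists (i, val r).
    rewrite /prism_adj /= j3 ltn_ord eqxx /=.
    by move: ne; rewrite -val_eqE /= inordK // => ->.
  by congr pair; rewrite /= inord_val.
move=> /eqP<- /andP[_ /orP[] /eqP /= E].
  exists (i.+1, j); first by rewrite /prism_adj /= j3 !eqxx orbT.
  congr pair; apply: val_inj; rewrite /= E -addn1 modnDml; congr modn; lia.
exists (i.-1, j).
  by rewrite /prism_adj /= j3 prednK // !eqxx !orbT.
congr pair; apply: val_inj; rewrite /= -[LHS](modn_small (ltn_ord z)).
apply/eqP; rewrite -(eqn_modDr 1) addn1 -E; apply/eqP; congr modn; lia.
Qed.

(** Local injectivity: neighbors of a vertex lie at most two columns apart, and such columns stay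
    distinct modulo [n >= 3]. *)
Lemma roll_inj x u v v' : prism_adj u v -> prism_adj u v' ->
  roll x v = roll x v' -> v = v'.
Proof.
case: u v v' => [i j] [i1 j1] [i2 j2] uv uv' [].
move/(congr1 val); rewrite /= !inordK; try by [case/and3P: uv | case/and3P: uv'].
move=> Ej E; congr pair => //; apply/(@addnI x).
wlog le : i1 i2 j1 j2 uv uv' Ej E / i1 <= i2.
  by move=> wl; case/orP: (leq_total i1 i2) => le;
     [apply: (wl i1 i2 j1 j2) | apply/esym; apply: (wl i2 i1 j2 j1)].
apply: (modn_near n3) E.
by move: uv uv'; rewrite /prism_adj /=; lia.
Qed.

Lemma pullback_coloring k col x : star_walk_coloring (@adj G) k col ->
  star_walk_coloring prism_adj k (fun u v => col (roll x u) (roll x v)).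
Proof.
case=> colC colk colP colS.
have inj u v v' : prism_adj u v -> prism_adj u v' -> v != v' ->
    roll x v != roll x v'.
  by move=> uv uv'; apply: contra_neq => /(roll_inj uv uv').
split=> [u v /(roll_adj x)/colC // | u v /(roll_adj x)/colk // | |].
  by move=> u v v' uv uv' ne; apply: colP; [apply: roll_adj.. | apply: inj uv uv' ne].
move=> v0 v1 v2 v3 v4 a01 a12 a23 a34 n02 n13 n24.
apply: colS; try exact: roll_adj.
- by apply: inj n02; [rewrite prism_adj_sym; exact: a01 | ].
- by apply: inj n13; [rewrite prism_adj_sym; exact: a12 | ].
- by apply: inj n24; [rewrite prism_adj_sym; exact: a23 | ].
Qed.

Lemma not_colorable5 k : k <= 5 -> ~~ star_edge_colorable G k.
Proof.
move=> k5; apply/negP => /walk_coloring_of_star[col colP].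
have [c1 c2 c3 c4] := pullback_coloring 0 colP.
apply: (@prism_not5 (fun u v => col (roll 0 u) (roll 0 v))).
by split=> // u v /c2 /leq_trans; apply.
Qed.

Lemma not_colorable6 k : ~~ (3 %| n) -> k <= 6 -> ~~ star_edge_colorable G k.
Proof.
move=> n_ndiv k6; apply/negP => /walk_coloring_of_star[col colP].
pose a x := col (roll x (0, 0)) (roll x (0, 1)).
have aP x : a (x + 3) = a x /\ a (x + 1) != a x.
  have [c1 c2 c3 c4] := pullback_coloring x colP; rewrite /a !roll_shift.
  apply: (@prism_6_periodic (fun u v => col (roll x u) (roll x v))).
  by split=> // u v /c2 /leq_trans; apply.
have a3 m x : a (x + 3 * m) = a x.
  elim: m => [|m IH]; first by rewrite muln0 addn0.
  by rewrite mulnS addnCA addnC; have [-> _] := aP (x + 3 * m).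
have an x : a (x + n) = a x by rewrite /a !roll_period.
have E : a (0 + n) = a 0 by apply: an.
have r12 : n %% 3 = 1 \/ n %% 3 = 2 by move: n_ndiv; rewrite /dvdn; lia.
have := a3 (n %/ 3) (n %% 3); rewrite addnC mulnC -divn_eq -[n in a n]add0n E.
(* If [n] is 1 modulo 3, going around gives [a 1 = a 0]; if it is 2, [a 2 = a 0 = a 3]. Both
   contradict that consecutive columns differ. *)
have [_ a10] := aP 0; have [_ a21] := aP 2; have [a30 _] := aP 0.
by case: r12 => -> Er; [rewrite Er eqxx in a10 | rewrite a30 Er eqxx in a21].
Qed.
End Covering.

(** * Periodic colorings *)

(** Five columns hold every walk of four edges whose middle vertex lies in column 2. *)
Definition local_vertices := [seq (i, j) | i <- iota 0 5, j <- iota 0 3].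

Definition local_nbrs v := [seq u <- local_vertices | prism_adj v u].

Definition star_at k (c : nat * nat -> nat * nat -> nat) v2 :=
  all (fun v1 => [&& c v2 v1 == c v1 v2, c v2 v1 < k &
    all (fun v3 => (v1 == v3) || (c v2 v1 != c v2 v3) &&
      all (fun v0 => (v0 == v2) || all (fun v4 => (v4 == v2) ||
        ~~ ((c v0 v1 == c v2 v3) && (c v1 v2 == c v3 v4)))
      (local_nbrs v3)) (local_nbrs v1))
    (local_nbrs v2)]) (local_nbrs v2).

Section Descent.
Variables (n : nat) (n3 : 2 < n).
Notation G := (cart_prod (cycle_graph 3) (cycle_graph n)).

Lemma roll_center (v : G) : exists x j, j < 3 /\ v = roll n3 x (2, j).
Proof.
(* Adding [n] keeps the subtraction from truncating. *)
case: v => r z; exists (z + n - 2), (val r); split; first exact: ltn_ord.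
congr pair; first by rewrite /= inord_val.
apply: val_inj; rewrite /= subnK; last by lia.
by rewrite modnDr modn_small.
Qed.

Lemma local_nbrsI i j v : i < 4 -> prism_adj (i, j) v -> v \in local_nbrs (i, j).
Proof.
case: v => i' j' i4 uv; rewrite mem_filter uv.
apply/allpairsPdep; exists i', j'; rewrite !mem_iota.
by move: uv; rewrite /prism_adj /=; split=> //; lia.
Qed.

(** Each condition is centered at one vertex, the middle one for a walk, and that vertex lifts to
    column 2, where [c] has been tested. *)
Lemma star_walk_of_local k (col : G -> G -> nat) :
  (forall x, exists2 c,
     {in local_vertices &, forall u v, prism_adj u v ->
        col (roll n3 x u) (roll n3 x v) = c u v} &
     forall j, j < 3 -> star_at k c (2, j)) ->
  star_walk_coloring (@adj G) k col.
Proof.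
move=> loc.
have nb x j y : j < 3 -> adj (roll n3 x (2, j)) y ->
    exists2 v, v \in local_nbrs (2, j) & y = roll n3 x v.
  by move=> j3 /roll_lift[] // v uv ->; exists v => //; apply: local_nbrsI.
have nb2 x j v y : v \in local_nbrs (2, j) -> adj (roll n3 x v) y ->
    exists2 v', v' \in local_nbrs v & y = roll n3 x v'.
  case: v => i' j'; rewrite mem_filter => /andP[uv _].
  have [i1 i4 j3] : [/\ 0 < i', i' < 4 & j' < 3].
    by move: uv; rewrite /prism_adj /=; split; lia.
  by case/roll_lift=> // v vv ->; exists v => //; apply: local_nbrsI.
have cen j : j < 3 -> (2, j) \in local_vertices.
  by move=> j3; apply/allpairsPdep; exists 2, j; rewrite !mem_iota; split.
have memE v u : u \in local_nbrs v -> prism_adj v u /\ u \in local_vertices.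
  by rewrite mem_filter => /andP[].
have sw (x y : G) (xy : adj x y) : adj y x by rewrite adj_sym.
split.
- move=> u v; have [x [j [j3 ->]]] := roll_center u.
  have [c cE cP] := loc x; case/nb=> // y yN ->.
  have [uy yV] := memE _ _ yN; have uV := cen _ j3.
  have /and3P[/eqP E _ _] := allP (cP j j3) y yN.
  by rewrite !cE // prism_adj_sym.
- move=> u v; have [x [j [j3 ->]]] := roll_center u.
  have [c cE cP] := loc x; case/nb=> // y yN ->.
  have [uy yV] := memE _ _ yN; have uV := cen _ j3.
  have /and3P[_ lt _] := allP (cP j j3) y yN.
  by rewrite !cE.
- move=> u v v'; have [x [j [j3 ->]]] := roll_center u.
  have [c cE cP] := loc x; case/nb=> // y yN -> /nb[] // z zN -> ne.
  have [uy yV] := memE _ _ yN; have [uz zV] := memE _ _ zN; have uV := cen _ j3.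
  have /and3P[_ _ /allP/(_ z zN)] := allP (cP j j3) y yN.
  rewrite !cE //; have [E|_ /andP[]//] := eqVneq y z.
  by rewrite E eqxx in ne.
- move=> v0 v1 v2 v3 v4; have [x [j [j3 ->]]] := roll_center v2.
  move=> /sw a10 /sw /nb[] // y1 N1 E1 /nb[] // y3 N3 E3; rewrite {}E1 {}E3 in a10 *.
  case/(nb2 _ _ _ _ N1): a10 => y0 N0 ->; case/(nb2 _ _ _ _ N3)=> y4 N4 -> n02 n13 n24.
  have [c cE cP] := loc x.
  have /and3P[_ _ /allP/(_ y3 N3)] := allP (cP j j3) y1 N1.
  have uV := cen _ j3.
  have [a1 V1] := memE _ _ N1; have [a3 V3] := memE _ _ N3.
  have [a0 V0] := memE _ _ N0; have [a4 V4] := memE _ _ N4.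
  rewrite !cE // 1?prism_adj_sym //.
  have [E|_] := eqVneq y1 y3; first by rewrite E eqxx in n13.
  move=> /andP[_ /allP/(_ y0 N0)].
  have [E|_] := eqVneq y0 (2, j); first by rewrite E eqxx in n02.
  move=> /allP/(_ y4 N4).
  by have [E|_] := eqVneq y4 (2, j); first by rewrite E eqxx in n24.
Qed.
End Descent.

(* A column type lists the colors of the triangle edges 01, 12, 20 and of the
   rungs 0, 1, 2 to the next column.  Row sums 1, 3, 2 identify the edges 01, 12
   and 20. *)
Definition triangle_color (ty : seq nat) (j : nat) := nth 0 ty (nth 0 [:: 0; 0; 2; 1] j).
Definition rung_color (ty : seq nat) (j : nat) := nth 0 ty (3 + j).

Definition pattern_color (types : seq (seq nat)) (ss : seq nat) (u v : nat * nat) :=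
  if u.1 == v.1 then triangle_color (nth [::] types (nth 0 ss u.1)) (u.2 + v.2)
  else rung_color (nth [::] types (nth 0 ss (minn u.1 v.1))) u.2.

(* Types 0, 1, 2 form the block of period 3 and types 3, ..., q + 2 the inserted
   block of [q] columns; [succs] lists the types allowed in the next column. *)
Definition succs (q a : nat) : seq nat :=
  if (a == 2) || (a == q + 2) then (if q is 0 then [:: 0] else [:: 0; 3])
  else [:: a.+1].

Fixpoint type_paths (q m a : nat) : seq (seq nat) :=
  if m is m'.+1 then [seq a :: p | b <- succs q a, p <- type_paths q m' b]
  else [:: [:: a]].

Lemma mem_type_paths q a p : path (fun a b => b \in succs q a) a p ->
  a :: p \in type_paths q (size p) a.
Proof.
elim: p a => [|b p IH] a /=; first by rewrite inE.
case/andP=> ab bp; apply/allpairsPdep; exists b, (b :: p); split=> //.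
exact: IH.
Qed.

Definition pattern_ok (k q : nat) (types : seq (seq nat)) :=
  all (fun a => all (fun ss => all (fun j =>
      star_at k (pattern_color types ss) (2, j)) (iota 0 3))
    (type_paths q 4 a)) (iota 0 (q + 3)).

(** The period-3 block fills the first [n - q] columns and the inserted block the last [q]. For
    [n = q] only the latter remains and follows itself, hence the successor 3 of [q + 2] in
    [succs]. *)
Definition word (n q i : nat) := if i < n - q then i %% 3 else 3 + (i - (n - q)).

Lemma word_succ n q i : 2 < n -> q <= n -> 3 %| n - q -> i < n ->
  word n q (i.+1 %% n) \in succs q (word n q i).
Proof.
move=> n3 qn /dvdnP[m nq] i_n; rewrite /word /succs.
have [lt_i | ge_i] := ltnP i.+1 n.
  rewrite modn_small //.
  case: q qn nq => [|q] qn nq; do ![case: ifP]; rewrite !inE; lia.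
have -> : i.+1 = n by lia.
rewrite modnn mod0n.
case: q qn nq => [|q] qn nq; do ![case: ifP]; rewrite !inE; lia.
Qed.

Lemma word_bound n q i : i < n -> word n q i < q + 3.
Proof. by rewrite /word; case: ifP; lia. Qed.

Section Pattern.
Variables (n : nat) (n3 : 2 < n).
Notation G := (cart_prod (cycle_graph 3) (cycle_graph n)).
Variables (k q : nat) (types : seq (seq nat)).

Definition word_color (u v : G) :=
  let ty (i : nat) := nth [::] types (word n q i) in
  if u.2 == v.2 then triangle_color (ty u.2) (u.1 + v.1)
  else rung_color (ty (if val v.2 == u.2.+1 %% n then u.2 else v.2)) u.1.

Lemma word_colorable : pattern_ok k.+1 q types -> q <= n -> 3 %| n - q ->
  star_edge_colorable G k.+1.
Proof.
move=> ok qn nq; apply: (@star_of_walk_coloring _ _ word_color).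
apply: (star_walk_of_local (n3 := n3)) => x.
pose s i := word n q ((x + i) %% n).
have n_gt0 : 0 < n by lia.
have s_succ i : s i.+1 \in succs q (s i).
  rewrite /s addnS; have := word_succ n3 qn nq (ltn_pmod (x + i) n_gt0).
  by rewrite -[((x + i) %% n).+1]addn1 modnDml addn1.
exists (pattern_color types [:: s 0; s 1; s 2; s 3; s 4]); last first.
  move=> j j3; have s0 : s 0 \in iota 0 (q + 3).
    by rewrite mem_iota word_bound // ltn_pmod.
  have /allP ok0 := allP ok (s 0) s0.
  have /ok0/allP : [:: s 0; s 1; s 2; s 3; s 4] \in type_paths q 4 (s 0).
    by apply: (@mem_type_paths q (s 0) [:: s 1; s 2; s 3; s 4]); rewrite /= !s_succ.
  by apply; rewrite mem_iota.
move=> [i j] [i' j'] /allpairsPdep[a [_ [i5 _ [Ei _]]]]; rewrite -{a}Ei in i5.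
case/allpairsPdep=> [a [_ [i5' _ [Ei _]]]]; rewrite -{a}Ei in i5'.
have nths a : a \in iota 0 5 -> nth 0 [:: s 0; s 1; s 2; s 3; s 4] a = s a.
  by rewrite !inE => /or4P[||| /orP[]] /eqP->.
move=> /and3P[/= j3 j3' uv]; rewrite /word_color /pattern_color /= -val_eqE /=.
rewrite !inordK //; case/orP: uv => /andP[/eqP E ne].
  by rewrite -E eqxx nths // eqxx.
have near a : (x + a) %% n == (x + a.+1) %% n = false.
  by apply/negP => /eqP /(modn_near n3); lia.
have sS a : ((x + a) %% n).+1 %% n = (x + a.+1) %% n.
  by rewrite -addn1 modnDml addn1 addnS.
case/orP: ne => /eqP Ei.
  by rewrite (minn_idPl _) ?Ei // nths // near sS eqxx ltn_eqF // E.
have -> : minn i i' = i' by apply/minn_idPr; rewrite Ei.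
rewrite (nths _ i5') Ei eq_sym near.
(* The rung joins column [i'.+1] to column [i'] on its left; the opposite reading would identify
   columns two apart modulo [n]. *)
case: ifP => [|_]; last by rewrite eq_sym ltn_eqF.
by rewrite sS => /eqP /(modn_near n3); lia.
Qed.
End Pattern.

(** Triangles use the colors 0, 1, 2 and rungs 3, 4, 5; from one column to the next they are rotated
    in opposite directions. *)
Definition A_types := [:: [:: 0;1;2;3;4;5]; [:: 1;2;0;5;3;4]; [:: 2;0;1;4;5;3]].
(** Here and in [C_types] the inserted block opens with a copy of the column of type 0. *)
Definition B_types := A_types ++
  [:: [:: 0;1;2;3;4;5]; [:: 1;2;6;0;6;3]; [:: 5;4;2;6;3;1]; [:: 2;0;3;4;5;6]].
Definition C_types := A_types ++
  [:: [:: 0;1;2;3;4;5]; [:: 1;2;0;5;3;6]; [:: 2;0;1;6;4;2]; [:: 0;5;3;5;6;4];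
      [:: 2;3;1;4;5;6]].

Lemma A_types_ok : pattern_ok 6 0 A_types.
Proof. by vm_compute. Qed.

Lemma B_types_ok : pattern_ok 7 4 B_types.
Proof. by vm_compute. Qed.

Lemma C_types_ok : pattern_ok 7 5 C_types.
Proof. by vm_compute. Qed.

Theorem theorem11 (n : nat) (hn : 3 <= n) :
  star_chromatic_index (cart_prod (cycle_graph 3) (cycle_graph n)) =
  if 3 %| n then 6 else 7.
Proof.
rewrite /star_chromatic_index; case: ex_minnP => m col_m min_m.
apply/eqP; rewrite eqn_leq; apply/andP; split.
  apply: min_m; case: ifP => n_div.
    by apply: (word_colorable hn (q := 0) A_types_ok); rewrite ?subn0.
  (* The inserted block fits, as 4 and 5 are the least [n >= 3] in their classes modulo 3. *)
  have [n1 | n2] : n %% 3 = 1 \/ n %% 3 = 2 by move: n_div; rewrite /dvdn; lia.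
    by apply: (word_colorable hn (q := 4) B_types_ok); rewrite /dvdn; lia.
  by apply: (word_colorable hn (q := 5) C_types_ok); rewrite /dvdn; lia.
rewrite leqNgt; apply: contraL col_m; case: ifP => n_div.
  exact: not_colorable5.
by apply: not_colorable6; rewrite ?n_div.
Qed.
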